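(* Let $p$ satisfy hypothesis (H) on $(a,b)$, with $p_h(t,0)\neq0$ for all $t\in(a,b)$, $p_h(\cdot,0)$ continuous on $(a,b)$, and $1/p_h(\cdot,0)\in L^1(a,b)$. Let $f:[a,b]\to\mathbb{R}$ be continuous. Then $D_p(I_p(f))(t)=f(t)$ for every $t\in(a,b)$.
   Context: Here $p(t,h)$ is a real-valued function defined for $t\in(a,b)$ and $|h|<\delta$, where $\delta>0$ is generally unspecified (it may depend on $t$), with values in $[a,b]$, and $p_h=\partial p/\partial h$. The $p$-derivative of a function $g:[a,b]\to\mathbb{R}$ at $t\in(a,b)$ is $$D_pg(t)=\lim_{h\to0}\frac{g(p(t,h))-g(t)}{h},$$ whenever the limit exists and is finite. For continuous $f:[a,b]\to\mathbb{R}$, $$I_p(f)(t)=\int_a^t\frac{f(x)}{p_h(x,0)}\,dx,\qquad t\in[a,b].$$ Hypothesis (H) on $(a,b)$: for each $t\in(a,b)$, $p(t,h)$ and $p_h(t,h)$ exist and are continuous (in $h$) in a neighborhood of $h=0$; and for each $t\in(a,b)$, for each choice of sign and all sufficiently small $\varepsilon>0$, the equation $p(t,h)=t\pm\varepsilon$ has a solution $h=h(t,\varepsilon)$ such that $h\to0$ as $\varepsilon\to0$. *)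

(* Defs.v *)
From HB Require Import structures.
From mathcomp Require Import all_boot all_order all_algebra.
From mathcomp Require Import all_classical all_reals all_analysis.
Set Implicit Arguments.
Unset Strict Implicit.
Unset Printing Implicit Defensive.
Import Order.TTheory GRing.Theory Num.Theory.
Import numFieldNormedType.Exports.
Local Open Scope classical_set_scope.
Local Open Scope ring_scope.

(* A function p(t, h) that is only given for t in (a, b) and |h| < delta(t) is
   represented by an arbitrary total extension R -> R -> R. Every notion below
   depends on p t only through its germ at h = 0, for t in (a, b). *)

Definition partial_h (R : realType) (p : R -> R -> R) (t h : R) : R :=
  derive1 (p t) h.

(* For each t, some delta(t) > 0 is such that p(t, h) lies in [a, b] as soon as
   |h| < delta(t). *)
Definition maps_into_segment (R : realType) (a b : R) (p : R -> R -> R) : Prop :=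
  forall t : R, t \in `]a, b[ -> \forall h \near (0 : R), p t h \in `[a, b].

(* The boolean s is the choice of sign in p(t, h) = t +/- e, and sol e is the
   solution h(t, e). *)
Definition hypothesis_H (R : realType) (a b : R) (p : R -> R -> R) : Prop :=
  forall t : R, t \in `]a, b[ ->
    (\forall h \near (0 : R),
       [/\ {for h, continuous (p t)},
           derivable (p t) h 1 &
           {for h, continuous (partial_h p t)}]) /\
    (forall s : bool, exists sol : R -> R,
       (\forall e \near (0 : R)^'+, p t (sol e) = t + (-1) ^+ s * e) /\
       sol e @[e --> (0 : R)^'+] --> (0 : R)).

Definition p_quotient (R : realType) (p : R -> R -> R) (g : R -> R) (t h : R) :
  R := (g (p t h) - g t) / h.

Definition p_derivable (R : realType) (p : R -> R -> R) (g : R -> R) (t : R) :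
  Prop := cvg (p_quotient p g t h @[h --> (0 : R)^']).

Definition p_derive (R : realType) (p : R -> R -> R) (g : R -> R) (t : R) : R :=
  lim (p_quotient p g t h @[h --> (0 : R)^']).

(* The interval is open because p_h(x, 0) is meaningful only for x in (a, b);
   the endpoints have measure zero. *)
Definition p_integral (R : realType) (a : R) (p : R -> R -> R) (f : R -> R)
    (t : R) : R :=
  \int[lebesgue_measure]_(x in `]a, t[) (f x / partial_h p x 0).

(* Main.v *)
Require Import Defs.
From HB Require Import structures.
From mathcomp Require Import all_boot all_order all_algebra.
From mathcomp Require Import all_classical all_reals all_analysis.
From mathcomp Require Import measurable_realfun.
Set Implicit Arguments.
Unset Strict Implicit.
Unset Printing Implicit Defensive.
Import Order.TTheory GRing.Theory Num.Theory.
Import numFieldNormedType.Exports.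
Local Open Scope classical_set_scope.
Local Open Scope ring_scope.

(** Under hypothesis (H) the p-derivative is an ordinary derivative in disguise.
    Indeed p(t, 0) = t, so the p-difference quotient of g at t is the ordinary
    difference quotient at h = 0 of the composite of g with h |-> p(t, h), and
    the chain rule gives D_p g(t) = g'(t) p_h(t, 0) wherever g is differentiable.
    For g = I_p(f) the fundamental theorem of calculus gives
    g'(t) = f(t) / p_h(t, 0), and the nonzero factor p_h(t, 0) cancels.

    Three facts carry this: the identity p(t, 0) = t ([hypothesis_H_p0]), the
    integrability of f / p_h(., 0) ([integrable_mul_continuous]) and the
    differentiability of the integral over ]a, y[ with respect to y
    ([is_derive_integral_oo]). *)

(** Hypothesis (H) does not mention p(t, 0); its value is forced by the
    solutions of p(t, h) = t + e. As e tends to 0+, these tend to 0, so by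
    continuity p(t, .) takes there values tending to p(t, 0), yet those values
    are t + e. *)
Lemma hypothesis_H_p0 (R : realType) (a b : R) (p : R -> R -> R) (t : R) :
  hypothesis_H a b p -> t \in `]a, b[ -> p t 0 = t.
Proof.
move=> hH tab; have [/nbhs_singleton[cp _ _] /(_ false)[sol [solE sol0]]] := hH t tab.
have psol : p t (sol e) @[e --> (0 : R)^'+] --> p t 0 by exact: cvg_comp sol0 cp.
have psolt : p t (sol e) @[e --> (0 : R)^'+] --> t.
  have te : t + e @[e --> (0 : R)^'+] --> t.
    rewrite -[X in _ --> X]addr0; apply: cvgD; first exact: cvg_cst.
    by apply: cvg_at_right_filter; exact: cvg_id.
  apply: cvg_trans te; apply: near_eq_cvg.
  by apply: filterS solE => e ->; rewrite expr0 mul1r.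
exact: cvg_unique psol psolt.
Qed.

(** The fundamental theorem of calculus at a point of continuity, for an
    integrand controlled only on the open interval: nothing is known of g at the
    endpoints or outside of ]a, b[. *)
Lemma is_derive_integral_oo (R : realType) (a b : R) (g : R -> R) (t : R) :
  lebesgue_measure.-integrable `]a, b[ (EFin \o g) ->
  t \in `]a, b[ -> {for t, continuous g} ->
  is_derive t 1 (fun y => \int[lebesgue_measure]_(x in `]a, y[) g x) (g t).
Proof.
move=> gi; rewrite in_itv/= => /andP[at_ tb] gt.
have gic y : y < b -> lebesgue_measure.-integrable `]a, y] (EFin \o g).
  by move=> yb; apply: integrableS gi => //; apply: subset_itvl; rewrite bnd_simp.
(* The fundamental theorem asks for integrability up to some point beyond t;
   the midpoint of t and b stays inside ]a, b[. *)
have tu : t < (t + b) / 2 by rewrite midf_lt.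
have ub : (t + b) / 2 < b by rewrite midf_lt.
have [dF dFE] := continuous_FTC1 (a := BRight a) tu (gic _ ub) at_ gt.
(* A single endpoint is negligible, but only for y < b is g known to be
   integrable up to y, so the two primitives are compared near t only. *)
have FG : \forall y \near t, \int[lebesgue_measure]_(x in `]a, y]) g x =
    \int[lebesgue_measure]_(x in `]a, y[) g x.
  have : \forall y \near t, y < b by exact: lt_nbhsl.
  apply: filterS => y yb; rewrite Rintegral_itv_bndo_bndc//.
  by apply: integrableS (gic _ yb) => //; apply: subset_itvl; rewrite bnd_simp.
apply: near_eq_is_derive FG _ => //.
by rewrite -dFE derive1E; exact: derivableP.
Qed.

(** A continuous function on the segment is bounded by compactness, and a
    bounded measurable factor preserves integrability. *)
Lemma integrable_mul_continuous (R : realType) (a b : R) (f g : R -> R) :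
  {within `[a, b], continuous f} ->
  lebesgue_measure.-integrable `]a, b[ (EFin \o g) ->
  lebesgue_measure.-integrable `]a, b[ (EFin \o (f \* g)).
Proof.
move=> cf gi; have sub : `]a, b[ `<=` `[a, b] by exact: subset_itv_oo_cc.
rewrite (_ : EFin \o _ = (EFin \o f) \* (EFin \o g))%E; last first.
  by apply/funext => x /=; rewrite EFinM.
apply: integrableMr => //.
  apply: measurable_funS sub _ => //.
  by apply: subspace_continuous_measurable_fun.
have /compact_bounded[M [_ mrt]] := continuous_compact cf (@segment_compact _ a b).
exists M; split; rewrite ?num_real // => y My x xab; apply: mrt My _ _.
by exists x => //; exact: sub.
Qed.

Theorem theorem4p3 (R : realType) (a b : R) (p : R -> R -> R) (f : R -> R)
  (hab : a < b)
  (hp : maps_into_segment a b p)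
  (hH : hypothesis_H a b p)
  (hp0 : forall t : R, t \in `]a, b[ -> partial_h p t 0 != 0)
  (hpc : {in `]a, b[, continuous (fun t : R => partial_h p t 0)})
  (hpL1 : lebesgue_measure.-integrable `]a, b[
            (fun t : R => ((partial_h p t 0)^-1)%:E))
  (hf : {within `[a, b], continuous f}) :
  forall t : R, t \in `]a, b[ ->
    p_derivable p (p_integral a p f) t /\
    p_derive p (p_integral a p f) t = f t.
Proof.
move=> t tab.
have pt0 := hypothesis_H_p0 hH tab.
have dp : is_derive (0 : R) (1 : R) (p t) (partial_h p t 0).
  have [/nbhs_singleton[_ dp _] _] := hH t tab.
  by rewrite /partial_h derive1E; exact: derivableP.
have dI : is_derive (p t 0) (1 : R) (p_integral a p f) (f t / partial_h p t 0).
  rewrite pt0; apply: (is_derive_integral_oo (b := b)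
    (g := fun x => f x / partial_h p x 0)) => //.
    exact: (integrable_mul_continuous hf hpL1).
  apply: cvgM; first exact: within_continuous_continuous hab hf tab.
  by apply: cvgV; [exact: hp0 | exact: hpc].
have dc : is_derive (0 : R) (1 : R) (p_integral a p f \o p t) (f t).
  by have := is_derive1_comp dI dp; rewrite divfK// hp0.
suff : p_quotient p (p_integral a p f) t h @[h --> (0 : R)^'] --> f t.
  by move=> qf; split; [apply/cvg_ex; exists (f t) | exact: cvg_lim qf].
have [dv <-] := dc.
rewrite (_ : p_quotient p _ t = fun h => h^-1 *:
  ((p_integral a p f \o p t \o shift 0) (h *: 1) - (p_integral a p f \o p t) 0)).
  exact: dv.
apply/funext => h; rewrite /p_quotient /= addr0 pt0.
by rewrite [h *: 1]mulr1 mulrC.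
Qed.
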